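(* Let $f\in\mathrm{Diff}^{2}_0([0,1])$. If $E_1(f)=\emptyset$ and $E_2(f)\ne\emptyset$, then $\Gamma_n(f)\asymp n^2$ as $n\to\infty$. If $E_1(f)=E_2(f)=\emptyset$, then $\Gamma_n(f)=o(n^2)$ as $n\to\infty$.
   Context: $\mathrm{Diff}^{2}_0([0,1])$ is the group of all $C^2$-smooth diffeomorphisms of $[0,1]$ onto itself fixing the endpoints $0$ and $1$. For such $f$, $f^n$ ($n\ge1$) is the $n$-th iterate of $f$ and $f^{-n}$ is the $n$-th iterate of $f^{-1}$. The growth sequence of $f$ is $$\Gamma_n(f)=\max\bigl(\max_{x\in[0,1]}|(f^n)'(x)|,\ \max_{x\in[0,1]}|(f^{-n})'(x)|\bigr),\qquad n\ge1.$$ $E(f)=\{x\in[0,1]:f(x)=x\}$ is the set of fixed points of $f$; $E_1(f)=\{x\in E(f): f'(x)\ne1\}$; $E_2(f)=\{x\in E(f): f'(x)=1,\ f''(x)\neq0\}$. The notation $a(n)\asymp b(n)$, $n\to\infty$, means that $0<c\le a(n)/b(n)\le C<\infty$ for some constants $c,C$ independent of $n$. *)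

(* Defs.v *)
From HB Require Import structures.
From mathcomp Require Import all_boot all_order all_algebra.
From mathcomp Require Import all_classical all_reals all_analysis.

Set Implicit Arguments.
Unset Strict Implicit.
Unset Printing Implicit Defensive.

Import Order.TTheory GRing.Theory Num.Theory.
Import numFieldNormedType.Exports.

Local Open Scope classical_set_scope.
Local Open Scope ring_scope.

Definition I01 (R : realType) : set R := `[0, 1]%classic.

Definition diff_quot (R : realType) (f : R -> R) (x y : R) : R :=
  (f y - f x) / (y - x).

(* Maps of [0, 1] are represented by functions R -> R whose values outside
   [0, 1] play no role.  Derivatives are therefore taken along [0, 1] only:
   they are the usual ones in ]0, 1[ and one-sided at 0 and 1. *)
Definition derivableI (R : realType) (f : R -> R) (x : R) : Prop :=
  cvg (diff_quot f x y @[y --> within (@I01 R) x^']).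

Definition derivI (R : realType) (f : R -> R) (x : R) : R :=
  lim (diff_quot f x y @[y --> within (@I01 R) x^']).

Definition C2I (R : realType) (f : R -> R) : Prop :=
  [/\ forall x, I01 x -> derivableI f x,
      forall x, I01 x -> derivableI (derivI f) x
    & {within @I01 R, continuous (derivI (derivI f))}].

(* For f a bijection of [0, 1], this is its inverse on [0, 1]. *)
Definition invI (R : realType) (f : R -> R) : R -> R := pinv (@I01 R) f.

Definition Diff20 (R : realType) (f : R -> R) : Prop :=
  [/\ set_bij (@I01 R) (@I01 R) f, C2I f, C2I (invI f), f 0 = 0 & f 1 = 1].

(* When g is C^1 on [0, 1], this supremum is the maximum of |g'|. *)
Definition max_deriv (R : realType) (g : R -> R) : R :=
  sup [set `|derivI g x| | x in @I01 R].

Definition growth (R : realType) (f : R -> R) (n : nat) : R :=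
  Num.max (max_deriv (iter n f)) (max_deriv (iter n (invI f))).

Definition fixed_points (R : realType) (f : R -> R) : set R :=
  [set x | I01 x /\ f x = x].

Definition E1 (R : realType) (f : R -> R) : set R :=
  [set x | fixed_points f x /\ derivI f x <> 1].

Definition E2 (R : realType) (f : R -> R) : set R :=
  [set x | [/\ fixed_points f x, derivI f x = 1 & derivI (derivI f) x <> 0]].

(* Sequences are indexed from 1. *)
Definition same_order (R : realType) (a b : nat -> R) : Prop :=
  exists c C : R, 0 < c /\ forall n, (1 <= n)%N -> c <= a n / b n <= C.

(* Main.v *)
(* Write G x = |f x - x|.  Along an orbit x_k = f^k(x) one has
   G (x_{k+1}) = f'(z_k) G (x_k) with z_k between x_k and x_{k+1}; orbits are
   monotone and f' is Lipschitz, so (f^n)'(x) is comparable with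
   G (x_n) / G (x), uniformly in n and x.

   Upper bounds.  If |f''| <= B wherever G < eta and f' = 1 at all fixed points,
   then |f' - 1|^2 <= 2 B G wherever G < eta (Landau's inequality).  Hence
   1 / sqrt (G x_k) decreases by at most O(sqrt B) per step as long as G is small, which gives
   (f^n)' <= C (A + C sqrt B n)^2 with C independent of B and eta.  Taking
   B = max |f''| yields O(n^2); when f'' vanishes at all fixed points, B can be
   taken arbitrarily small.  The inequality passes to f^{-1}.

   Lower bound.  Near a fixed point a with f''(a) <> 0, some orbit of f or of
   f^{-1} tends to a with |x_n - a| = O(1 / n), so G (x_n) = O(1 / n^2); following
   it backwards from x_n to x_0 gives a derivative of order n^2. *)
Require Import Defs.
From mathcomp Require Import all_boot all_order all_algebra.
From mathcomp Require Import all_classical all_reals all_analysis.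
From mathcomp Require Import ring lra.

Set Implicit Arguments.
Unset Strict Implicit.
Unset Printing Implicit Defensive.

Import Order.TTheory GRing.Theory Num.Theory.
Import numFieldNormedType.Exports.

Local Open Scope classical_set_scope.
Local Open Scope ring_scope.

(** * Derivatives along [0, 1] *)

(** Without a quotient, [y = x] is allowed, so the chain rule needs no separate case where the inner
    increment vanishes. *)
Definition has_derivI (R : realType) (f : R -> R) (x l : R) : Prop :=
  forall e, 0 < e -> exists2 d, 0 < d &
    forall y, I01 y -> `|y - x| < d ->
      `|f y - f x - l * (y - x)| <= e * `|y - x|.

Lemma I01P (R : realType) (x : R) : I01 x <-> 0 <= x <= 1.
Proof. by rewrite /I01 /= in_itv /=. Qed.

Section DerivativeAlongI01.
Variable R : realType.
Implicit Types (f g : R -> R) (x y l k : R).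

(** Every point of [0, 1] is an accumulation point: step inwards from the nearer end. This makes the
    limit in [derivI] unique. *)
Lemma I01_proper_dnbhs x : I01 x -> ProperFilter (within (@I01 R) x^').
Proof.
move=> /I01P /andP[x0 x1].
apply: Build_ProperFilter_ex => P [e /= e0 He].
have [x12|x12] := leP x (1/2).
- have ? : 0 < Num.min (e / 2) (1 / 2) :> R by rewrite lt_min; apply/andP; split; lra.
  exists (x + Num.min (e/2) (1/2)); apply: He => /=.
  + rewrite opprD addrA subrr add0r normrN gtr0_norm// gt_min; apply/orP; left; lra.
  + by rewrite -subr_eq0 addrAC subrr add0r gt_eqF.
  + have := ge_min (1/2) (e/2) (1/2 : R); rewrite lexx orbT => h.
    by apply/I01P; lra.
- have ? : 0 < Num.min (e / 2) (1 / 2) :> R by rewrite lt_min; apply/andP; split; lra.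
  exists (x - Num.min (e/2) (1/2)); apply: He => /=.
  + rewrite opprB addrCA subrr addr0 gtr0_norm// gt_min; apply/orP; left; lra.
  + by rewrite -subr_eq0 addrAC subrr add0r oppr_eq0 gt_eqF.
  + have := ge_min (1/2) (e/2) (1/2 : R); rewrite lexx orbT => h.
    by apply/I01P; lra.
Qed.

Lemma has_derivI_cvg f x l :
  has_derivI f x l <-> diff_quot f x y @[y --> within (@I01 R) x^'] --> l.
Proof.
split=> [H|H].
- apply/cvgrPdist_le => e e0; have [d d0 Hd] := H _ e0.
  exists d => //= y /= yx ynx Iy; rewrite /diff_quot.
  have n0 : y - x != 0 by rewrite subr_eq0.
  have -> : l - (f y - f x) / (y - x) = - (f y - f x - l * (y - x)) / (y - x).
    by field.
  rewrite normrM normrN normfV ler_pdivrMr ?normr_gt0//; apply: Hd => //.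
  by rewrite distrC.
- move=> e e0; have Hn := (cvgrPdist_le _ _).1 H _ e0; have [d /= d0 Hd] := Hn.
  exists d => // y Iy yx; have [->|ynx] := eqVneq y x.
    by rewrite !subrr mulr0 subrr normr0 mulr0.
  have n0 : y - x != 0 by rewrite subr_eq0.
  have := Hd y; rewrite /ball_ /= distrC => /(_ yx ynx Iy).
  rewrite /diff_quot.
  have -> : l - (f y - f x) / (y - x) = - (f y - f x - l * (y - x)) / (y - x).
    by field.
  by rewrite normrM normrN normfV ler_pdivrMr ?normr_gt0.
Qed.

Lemma has_derivI_unique f x l : I01 x -> has_derivI f x l -> derivI f x = l.
Proof.
move=> Ix /has_derivI_cvg H; have := I01_proper_dnbhs Ix => PF.
exact/cvg_lim.
Qed.

Lemma derivableI_has_derivI f x : derivableI f x -> has_derivI f x (derivI f x).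
Proof. by move=> H; apply/has_derivI_cvg. Qed.

Lemma eq_has_derivI f g x l :
  (forall y, I01 y -> f y = g y) -> I01 x -> has_derivI f x l -> has_derivI g x l.
Proof.
move=> fg Ix H e /H[d d0 Hd]; exists d => // y Iy /(Hd _ Iy).
by rewrite !fg.
Qed.

Lemma has_derivI_cst (c : R) x : has_derivI (cst c) x 0.
Proof.
by move=> e e0; exists 1 => // y _ _; rewrite subrr mul0r subrr normr0 mulr_ge0// ltW.
Qed.

Lemma has_derivI_id x : has_derivI id x 1.
Proof.
by move=> e e0; exists 1 => // y _ _; rewrite mul1r subrr normr0 mulr_ge0// ltW.
Qed.

Lemma has_derivID f g x l k : has_derivI f x l -> has_derivI g x k ->
  has_derivI (fun y => f y + g y) x (l + k).
Proof.
move=> Hf Hg; apply/has_derivI_cvg.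
rewrite (_ : diff_quot _ _ = fun y => diff_quot f x y + diff_quot g x y).
  by apply: cvgD; exact/has_derivI_cvg.
by apply/funext => y; rewrite /diff_quot -mulrDl; congr (_ / _); ring.
Qed.

Lemma has_derivIZ (c : R) f x l : has_derivI f x l ->
  has_derivI (fun y => c * f y) x (c * l).
Proof.
move=> Hf; apply/has_derivI_cvg.
rewrite (_ : diff_quot _ _ = fun y => c * diff_quot f x y).
  by apply: cvgMr; exact/has_derivI_cvg.
by apply/funext => y; rewrite /diff_quot mulrA; congr (_ / _); ring.
Qed.

Lemma has_derivIB f g x l k : has_derivI f x l -> has_derivI g x k ->
  has_derivI (fun y => f y - g y) x (l - k).
Proof.
move=> Hf /(has_derivIZ (-1)) Hg; have := has_derivID Hf Hg.
by rewrite mulN1r; under eq_fun do rewrite mulN1r.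
Qed.

Lemma has_derivI_lip f x l : has_derivI f x l -> exists2 d, 0 < d &
  forall y, I01 y -> `|y - x| < d -> `|f y - f x| <= (`|l| + 1) * `|y - x|.
Proof.
move=> /(_ 1 ltr01)[d d0 Hd]; exists d => // y Iy /(Hd _ Iy).
rewrite mul1r mulrDl mul1r -normrM => h.
rewrite -[f y - f x](subrK (l * (y - x))) (le_trans (ler_normD _ _))// addrC.
by rewrite lerD2l.
Qed.

Lemma has_derivI_near f x l (e : R) : has_derivI f x l -> 0 < e -> exists2 d, 0 < d &
  forall y, I01 y -> `|y - x| < d -> `|f y - f x| < e.
Proof.
move=> /has_derivI_lip[d d0 Hd] e0.
have l0 : 0 < `|l| + 1 by rewrite ltr_wpDl.
exists (Num.min d (e / (`|l| + 1))) => [|y Iy].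
  by rewrite lt_min d0 divr_gt0.
rewrite lt_min => /andP[/(Hd _ Iy) h1]; rewrite ltr_pdivlMr// mulrC.
exact: le_lt_trans.
Qed.

Lemma has_derivI_comp f g x l k : (forall y, I01 y -> I01 (g y)) -> I01 x ->
  has_derivI g x k -> has_derivI f (g x) l ->
  has_derivI (f \o g) x (l * k).
Proof.
move=> gI Ix Hg Hf e e0.
have [d1 d10 H1] := has_derivI_lip Hg.
have k0 : 0 < `|k| + 1 by rewrite ltr_wpDl.
have l0 : 0 < `|l| + 1 by rewrite ltr_wpDl.
(* Each error gets half of [e]: that of [f] is multiplied by the local Lipschitz constant |k| + 1 of
   [g], that of [g] by at most |l| + 1. *)
have [d2 d20 H2] := Hf _ (divr_gt0 (divr_gt0 e0 (@ltr0Sn R 1)) k0).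
have [d3 d30 H3] := Hg _ (divr_gt0 (divr_gt0 e0 (@ltr0Sn R 1)) l0).
have [d4 d40 H4] := has_derivI_near Hg d20.
exists (Num.min (Num.min d1 d3) d4) => [|y Iy]; first by rewrite !lt_min d10 d30 d40.
rewrite !lt_min -andbA => /and3P[y1 y3 y4] /=.
have := H2 _ (gI _ Iy) (H4 _ Iy y4); have := H3 _ Iy y3; have := H1 _ Iy y1.
set u := g y - g x => h1 h3 h2.
rewrite (_ : _ - _ = f (g y) - f (g x) - l * u + l * (u - k * (y - x))); last by ring.
rewrite (le_trans (ler_normD _ _))// normrM.
have -> : e * `|y - x| = e / 2 / (`|k| + 1) * ((`|k| + 1) * `|y - x|)
    + (`|l| + 1) * (e / 2 / (`|l| + 1) * `|y - x|).
  by field; rewrite !gt_eqF.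
apply: lerD.
  apply: (le_trans h2); apply: ler_wpM2l h1.
  by rewrite !divr_ge0// ltW.
by apply: ler_pM => //; rewrite lerDl.
Qed.

Lemma has_derivIM f g x l k : I01 x -> has_derivI f x l -> has_derivI g x k ->
  has_derivI (fun y => f y * g y) x (l * g x + f x * k).
Proof.
move=> Ix Hf Hg; apply/has_derivI_cvg.
rewrite (_ : diff_quot _ _ =
    fun y => diff_quot f x y * g y + f x * diff_quot g x y); last first.
  apply/funext => y; rewrite /diff_quot mulrA mulrAC -mulrDl.
  by congr (_ / _); ring.
apply: cvgD; last by apply: cvgMr; exact/has_derivI_cvg.
apply: cvgM; first exact/has_derivI_cvg.
apply/cvgrPdist_lt => e e0; have [d d0 Hd] := has_derivI_near Hg e0.
exists d => //= y /= yx _ Iy; rewrite distrC; apply: Hd => //.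
by rewrite distrC.
Qed.

Lemma has_derivI_continuous f (f1 : R -> R) (a b : R) :
  (forall x, I01 x -> has_derivI f x (f1 x)) -> 0 <= a -> b <= 1 ->
  {within `[a, b], continuous f}.
Proof.
move=> Hf a0 b1; apply/subspace_continuousP => x /=; rewrite in_itv/= => /andP[ax xb].
have Ix : I01 x by apply/I01P; rewrite (le_trans a0)//= (le_trans xb).
apply/cvgrPdist_lt => e e0; have [d d0 Hd] := has_derivI_near (Hf _ Ix) e0.
exists d => //= y /= yx; rewrite in_itv/= => /andP[ay yb]; rewrite distrC; apply: Hd.
  by apply/I01P; rewrite (le_trans a0)//= (le_trans yb).
by rewrite distrC.
Qed.

Lemma has_derivI_is_derive f x l : 0 < x < 1 -> has_derivI f x l -> is_derive x 1 f l.
Proof.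
move=> /andP[x0 x1] H.
suff C : h^-1 *: ((f \o shift x) (h *: (1:R)) - f x) @[h --> 0^'] --> l.
  by apply: DeriveDef; [apply/cvg_ex; exists l | exact/cvg_lim].
apply/cvgrPdist_le => e e0; have [d d0 Hd] := H _ e0.
exists (Num.min d (Num.min x (1 - x))); first by rewrite /= !lt_min d0 x0 subr_gt0.
move=> t /=; rewrite sub0r normrN !lt_min => /and3P[td tx t1] t0.
rewrite /GRing.scale /= mulr1.
have -> : l - t^-1 * (f (t + x) - f x) = - (f (t + x) - f x - l * (t + x - x)) / t.
  by field.
rewrite normrM normrN normfV ler_pdivrMr ?normr_gt0//.
have tE : t + x - x = t by rewrite addrK.
have := Hd (t + x); rewrite tE; apply => //.
by apply/I01P; move: tx t1; rewrite !ltr_norml; lra.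
Qed.

(* [c] lies between [x] and [y], in either order. *)
Lemma MVT_I01 f (f1 : R -> R) x y : (forall x, I01 x -> has_derivI f x (f1 x)) ->
  I01 x -> I01 y -> exists c, [/\ I01 c, 0 <= (c - x) * (y - c),
    `|c - x| <= `|y - x| & f y - f x = f1 c * (y - x)].
Proof.
move=> Hf; wlog xy : x y / x <= y.
  move=> W Ix Iy; have [xy|/ltW xy] := leP x y; first exact: W.
  have [c [Ic c1 c2 c3]] := W _ _ xy Iy Ix; exists c; split => //.
  - by rewrite mulrC -mulrNN !opprB.
  - move: c1; rewrite (distrC y) ler_norml ger0_norm ?subr_ge0// => c1.
    by have [] : y <= c /\ c <= x; [split; apply: contraT; rewrite -ltNge => ?; nra|move=> *; lra].
  - by rewrite -opprB c3 -mulrN opprB.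
move=> /I01P /andP[x0 x1] /I01P /andP[y0 y1].
have D z : z \in `]x, y[ -> is_derive z 1 f (f1 z).
  rewrite in_itv/= => /andP[xz zy]; apply: has_derivI_is_derive; first lra.
  by apply: Hf; apply/I01P; lra.
have [c] := MVT_segment xy D (has_derivI_continuous Hf x0 y1).
rewrite in_itv/= => /andP[xc cy] cE; exists c; split => //.
- by apply/I01P; lra.
- by rewrite mulr_ge0 ?subr_ge0.
- by rewrite !ger0_norm ?subr_ge0// lerB.
Qed.

End DerivativeAlongI01.

(** * Landau's inequality *)

Section LandauInequality.
Variable R : realType.
Implicit Types (u v g : R -> R) (x y B eta : R).

(** [y] is the infimum of the points of [x, 1] where [u] is nonnegative; continuity at [y] excludes
    both signs of [u y]. *)
Lemma first_zero u v x : (forall y, I01 y -> has_derivI u y (v y)) ->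
  I01 x -> u x < 0 -> 0 <= u 1 ->
  exists y, [/\ x < y <= 1, u y = 0 & forall t, x <= t < y -> u t < 0].
Proof.
move=> Hu /I01P /andP[x0 x1] ux u1.
pose S := [set t | x <= t <= 1 /\ 0 <= u t].
have S1 : S 1 by split => //; rewrite x1 lexx.
have Slb : lbound S x by move=> t [/andP[]].
have Si : has_inf S by split; [exists 1 | exists x].
pose y := inf S.
have xy : x <= y by apply: lb_le_inf => //; exists 1.
have yS t : S t -> y <= t by apply: ge_inf; exists x.
have y1 : y <= 1 by exact: yS.
have neg t : x <= t < y -> u t < 0.
  move=> /andP[xt ty]; rewrite ltNge; apply/negP => ut.
  by have := yS t (conj _ ut); rewrite xt (ltW (lt_le_trans ty y1)) leNgt ty; move/(_ isT).
have Iy : I01 y by apply/I01P; rewrite y1 (le_trans x0).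
have uy0 : 0 <= u y.
  rewrite leNgt; apply/negP => uy; have uy' : 0 < - u y by rewrite oppr_gt0.
  have [d d0 Hd] := has_derivI_near (Hu _ Iy) uy'.
  have [t St ty] := inf_adherent d0 Si.
  have yt := yS _ St; have [/andP[xt t1] ut] := St.
  have It : I01 t by apply/I01P; rewrite t1 (le_trans x0).
  have := Hd _ It; rewrite ger0_norm ?subr_ge0// ltrBlDl => /(_ ty).
  by rewrite ltr_norml; lra.
have xy' : x < y by rewrite lt_neqAle xy andbT; apply/eqP => xyE; move: ux; rewrite xyE ltNge uy0.
exists y; split; rewrite ?xy'//.
apply/eqP; rewrite eq_le uy0 andbT leNgt; apply/negP => uy.
have [d d0 Hd] := has_derivI_near (Hu _ Iy) uy.
pose t := Num.max x (y - d / 2).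
have ty : t < y by rewrite gt_max xy'/=; lra.
have xt : x <= t by rewrite le_max lexx.
have yt : y - d / 2 <= t by rewrite le_max lexx orbT.
have It : I01 t by apply/I01P; rewrite (le_trans x0)// (ltW (lt_le_trans ty y1)).
have := Hd _ It; rewrite distrC ger0_norm ?subr_ge0 ?(ltW ty)//.
have h : y - t < d by lra.
move=> /(_ h); have := neg t; rewrite xt ty => /(_ isT).
by rewrite ltr_norml; lra.
Qed.

(* With [y] the first zero of [g1] to the right of [x], the function
   [g1 ^+ 2 - 2 * B * g] is nondecreasing on [x, y] and nonpositive at [y]. *)
Lemma landau_ineq_decreasing g (g1 g2 : R -> R) B eta x :
  (forall y, I01 y -> has_derivI g y (g1 y)) ->
  (forall y, I01 y -> has_derivI g1 y (g2 y)) ->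
  (forall y, I01 y -> g y = 0 -> g1 y = 0) -> g 1 = 0 ->
  (forall y, I01 y -> `|g y| < eta -> `|g2 y| <= B) ->
  I01 x -> `|g x| < eta -> 0 <= g x -> g1 x < 0 -> g1 x ^+ 2 <= 2 * B * g x.
Proof.
move=> Hg Hg1 gz g10 HB Ix gxeta gx0 g1x.
have /andP[x0 x1] := (I01P x).1 Ix.
have I1 : I01 (1 : R) by apply/I01P; rewrite lexx ler01.
have [y [/andP[xy y1] g1y neg]] : exists y, [/\ x < y <= 1, g1 y = 0 &
    forall t, x <= t < y -> g1 t < 0].
  by apply: (first_zero Hg1) => //; rewrite gz.
have Iy : I01 y by apply/I01P; rewrite y1 (le_trans x0)// ltW.
have neg' t : x <= t <= y -> g1 t <= 0.
  move=> /andP[xt]; rewrite le_eqVlt => /orP[/eqP->|ty]; first by rewrite g1y.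
  by rewrite ltW// neg// xt.
have dec t : x <= t <= y -> 0 <= g t <= g x.
  move=> /andP[xt ty]; have It : I01 t by apply/I01P; rewrite (le_trans x0)// (le_trans ty).
  apply/andP; split.
    (* To become negative, [g] would first cross a zero; there [g1] vanishes by [gz], against
       [neg]. *)
    rewrite leNgt; apply/negP => gt0.
    have gc := has_derivI_continuous Hg x0 (le_trans ty y1).
    have [|z] := @IVT _ _ x t 0 xt gc.
      by rewrite ge_min le_max gx0 (ltW gt0) orbT.
    rewrite in_itv/= => /andP[xz zt] gz0.
    have zy : z < y.
      rewrite lt_neqAle (le_trans zt ty) andbT; apply/eqP => zyE.
      have tE : t = y by apply/eqP; rewrite eq_le ty -zyE zt.
      by move: gt0; rewrite tE -zyE gz0 ltxx.
    have Iz : I01 z by apply/I01P; lra.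
    by have := neg z; rewrite xz zy gz// => /(_ isT); rewrite ltxx.
  have [c [Ic c1 c2 c3]] := MVT_I01 Hg Ix It.
  rewrite -subr_le0 c3; apply: mulr_le0_ge0; last by rewrite subr_ge0.
  by apply: neg'; move: c1 c2; rewrite ler_norml [`|t - x|]ger0_norm ?subr_ge0//; nra.
have Hphi z : I01 z -> has_derivI (fun y => g1 y * g1 y - 2 * B * g y) z
    (g2 z * g1 z + g1 z * g2 z - 2 * B * g1 z).
  move=> Iz; apply: has_derivIB; last by apply: has_derivIZ; exact: Hg.
  by apply: has_derivIM => //; exact: Hg1.
have [c [Ic c1 c2 c3]] := MVT_I01 Hphi Ix Iy.
have cxy : x <= c <= y.
  by move: c1 c2; rewrite ler_norml [`|y - x|]ger0_norm ?subr_ge0 ?(ltW xy)//; nra.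
have /andP[gc0 gcx] := dec _ cxy.
(* As [g] stays below [g x] on [x, y], the point [c] remains where [g2] is bounded by [B]. *)
have /ler_normlP[_ g2c] : `|g2 c| <= B.
  by apply: HB => //; rewrite ger0_norm// (le_lt_trans gcx)// (le_lt_trans (ler_norm _)).
have /andP[gy0 _] : 0 <= g y <= g x by apply: dec; rewrite lexx andbT ltW.
have B0 : 0 <= B by rewrite (le_trans _ (HB _ Ix gxeta)).
have g1c := neg' _ cxy.
(* The derivative of the auxiliary function is 2 * g1 * (g2 - B), and both [g1] and g2 - B are
   nonpositive at [c]. *)
have : 0 <= (g2 c * g1 c + g1 c * g2 c - 2 * B * g1 c) * (y - x).
  by rewrite mulr_ge0 ?subr_ge0 ?(ltW xy)//; nra.
rewrite -c3 g1y mulr0 sub0r expr2 => h.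
have : 0 <= B * g y by rewrite mulr_ge0.
by lra.
Qed.

Lemma has_derivI_rev g (l : R) x : I01 x -> has_derivI g (1 - x) l ->
  has_derivI (fun y => g (1 - y)) x (- l).
Proof.
move=> Ix H; rewrite -[- l]mulrN1.
apply: (@has_derivI_comp _ g (fun y => 1 - y)) => //.
  by move=> y /I01P Iy; apply/I01P; lra.
rewrite -[-1]sub0r; apply: has_derivIB; first exact: has_derivI_cst.
exact: has_derivI_id.
Qed.

(** Passing to - g makes [g x] nonnegative, and reflecting [0, 1] makes the slope negative. Both
    endpoints are zeros of [g], hence of [g1], so [g1] has a zero on the side where [g] descends. *)
Lemma landau_ineq g (g1 g2 : R -> R) B eta x :
  (forall y, I01 y -> has_derivI g y (g1 y)) ->
  (forall y, I01 y -> has_derivI g1 y (g2 y)) ->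
  (forall y, I01 y -> g y = 0 -> g1 y = 0) -> g 0 = 0 -> g 1 = 0 ->
  (forall y, I01 y -> `|g y| < eta -> `|g2 y| <= B) ->
  I01 x -> `|g x| < eta -> g1 x ^+ 2 <= 2 * B * `|g x|.
Proof.
wlog gx0 : g g1 g2 / 0 <= g x.
  move=> W Hg Hg1 gz g00 g10 HB Ix gxeta.
  have [gx0|/ltW gx0] := leP 0 (g x); first exact: (W g g1 g2).
  rewrite -sqrrN -normrN.
  apply: (W (fun y => - g y) (fun y => - g1 y) (fun y => - g2 y)) => //.
  - by rewrite oppr_ge0.
  - move=> y /Hg /(has_derivIZ (-1)); rewrite mulN1r.
    by under eq_fun do rewrite mulN1r.
  - move=> y /Hg1 /(has_derivIZ (-1)); rewrite mulN1r.
    by under eq_fun do rewrite mulN1r.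
  - by move=> y Iy /eqP; rewrite oppr_eq0 => /eqP /gz -> //; rewrite oppr0.
  - by rewrite g00 oppr0.
  - by rewrite g10 oppr0.
  - by move=> y Iy; rewrite !normrN; exact: HB.
  - by rewrite normrN.
move=> Hg Hg1 gz g00 g10 HB Ix gxeta; rewrite (ger0_norm gx0).
have B0 : 0 <= B by rewrite (le_trans _ (HB _ Ix gxeta)).
have [g1x|g1x|->] := ltgtP (g1 x) 0.
- exact: (landau_ineq_decreasing Hg Hg1 gz g10 HB).
- have rI y : I01 y -> I01 (1 - y) by move=> /I01P Iy; apply/I01P; lra.
  rewrite -sqrrN; have xE : x = 1 - (1 - x) by rewrite subKr.
  rewrite xE.
  apply: (@landau_ineq_decreasing (fun y => g (1 - y)) (fun y => - g1 (1 - y))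
    (fun y => g2 (1 - y)) B eta).
  - by move=> y Iy; apply: has_derivI_rev => //; apply: Hg; exact: rI.
  - move=> y Iy; rewrite -[g2 _]opprK -mulN1r.
    rewrite (_ : (fun y => - _) = (fun y => -1 * g1 (1 - y))).
      by apply: has_derivIZ; apply: has_derivI_rev => //; apply: Hg1; exact: rI.
    by apply/funext => z; rewrite mulN1r.
  - by move=> y Iy /gz -> //; rewrite ?oppr0//; exact: rI.
  - by rewrite subrr.
  - by move=> y Iy; apply: HB; exact: rI.
  - exact: rI.
  - by rewrite subKr.
  - by rewrite subKr.
  - by rewrite subKr oppr_lt0.
- by rewrite expr0n /= !mulr_ge0.
Qed.

(** * Consequences of continuity on [0, 1] *)

Lemma within_I01_bounded u : {within @I01 R, continuous u} ->
  exists2 M : R, 0 <= M & forall x, I01 x -> `|u x| <= M.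
Proof.
move=> uc.
have [|c _ Hc] := @EVT_max R (fun x => `|u x|) 0 1 ler01.
  by move=> x; apply: cvg_norm; exact: uc.
by exists `|u c| => // x Ix; apply: Hc.
Qed.

(** Compactness through a minimum: [rho] is |g| + 2 max (0, B - |g2|), positive because [g2]
    vanishes where [g] does, and [eta] is its minimum. Where |g2| > B, [rho] reduces to |g|, so |g|
    >= eta. *)
Lemma small_second_derivative g (g1 g2 : R -> R) B :
  (forall y, I01 y -> has_derivI g y (g1 y)) ->
  {within @I01 R, continuous g2} ->
  (forall y, I01 y -> g y = 0 -> g2 y = 0) -> 0 < B ->
  exists2 eta, 0 < eta & forall y, I01 y -> `|g y| < eta -> `|g2 y| <= B.
Proof.
move=> Hg g2c gz B0; pose rho y := `|g y| + (B - `|g2 y| + `|B - `|g2 y| |).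
have gc : {within @I01 R, continuous g} := has_derivI_continuous Hg (lexx 0) (lexx 1).
have rhoc : {within @I01 R, continuous rho}.
  move=> x; apply: cvgD; first by apply: cvg_norm; exact: gc.
  have h : B - `|g2 y| @[y --> nbhs (x : subspace (@I01 R))] --> B - `|g2 x|.
    by apply: cvgB; [exact: cvg_cst | apply: cvg_norm; exact: g2c].
  by apply: cvgD => //; exact: cvg_norm.
have [c Ic Hc] := EVT_min ler01 rhoc.
exists (rho c) => [|y Iy].
  rewrite /rho; have [gc0|gc0] := eqVneq (g c) 0.
    by rewrite gz// gc0 !normr0 add0r subr0 gtr0_norm// addr_gt0.
  rewrite ltr_pwDl ?normr_gt0//.
  by have := ler_norm (- (B - `|g2 c|)); rewrite normrN; lra.
move=> gy; rewrite leNgt; apply/negP => g2y.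
have := lt_le_trans gy (Hc y Iy); rewrite /rho [`|B - _|]ltr0_norm ?subr_lt0//.
by rewrite subrr addr0 ltxx.
Qed.

Lemma within_I01_near u x (e : R) : {within @I01 R, continuous u} -> I01 x -> 0 < e ->
  exists2 d, 0 < d & forall y, I01 y -> `|y - x| < d -> `|u y - u x| < e.
Proof.
move=> /subspace_continuousP uc Ix e0.
have [d /= d0 Hd] := (cvgrPdist_lt _ _).1 (uc x Ix) _ e0.
exists d => // y Iy yx; rewrite distrC; apply: Hd => //=.
by rewrite distrC.
Qed.

(** Two mean value steps reduce the claim to s * g2 >= 2 * c near [x]. Continuity gives this, since
    2 * c is half of |g2 x|. *)
Lemma quadratic_growth g (g1 g2 : R -> R) x :
  (forall y, I01 y -> has_derivI g y (g1 y)) ->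
  (forall y, I01 y -> has_derivI g1 y (g2 y)) ->
  {within @I01 R, continuous g2} ->
  I01 x -> g x = 0 -> g1 x = 0 -> g2 x != 0 ->
  exists r c, [/\ 0 < r, 0 < c & forall y, I01 y -> `|y - x| <= r ->
    c * (y - x) ^+ 2 <= Num.sg (g2 x) * g y].
Proof.
move=> Hg Hg1 g2c Ix gx g1x g2x.
set s := Num.sg _; pose c := `|g2 x| / 4.
have g2x0 : 0 < `|g2 x| by rewrite normr_gt0.
have c0 : 0 < c by rewrite /c; lra.
have sE : s * g2 x = `|g2 x| by rewrite normrEsg.
have s1 : `|s| = 1 by rewrite normr_sg g2x.
have c20 : 0 < 2 * c by lra.
have [d d0 Hd] := within_I01_near g2c Ix c20.
have Hs y : I01 y -> `|y - x| < d -> 2 * c <= s * g2 y.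
  move=> Iy yx; have := Hd y Iy yx.
  have -> : `|g2 y - g2 x| = `|s * g2 y - s * g2 x|.
    by rewrite -mulrBr normrM s1 mul1r.
  by rewrite sE /c ltr_norml; lra.
exists (d / 2), c; split => //; first by lra.
move=> y Iy yx.
have Hpsi z : I01 z -> has_derivI (fun y => s * g y - c * ((y - x) * (y - x))) z
    (s * g1 z - c * ((1 - 0) * (z - x) + (z - x) * (1 - 0))).
  move=> Iz; apply: has_derivIB; first by apply: has_derivIZ; exact: Hg.
  have h : has_derivI (fun y => y - x) z (1 - 0).
    by apply: has_derivIB; [exact: has_derivI_id | exact: has_derivI_cst].
  by apply: has_derivIZ; apply: has_derivIM.
have [z [Iz z1 z2 z3]] := MVT_I01 Hpsi Ix Iy.
have [w [Iw w1 w2 w3]] := MVT_I01 Hg1 Ix Iz.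
have := Hs w Iw; rewrite (le_lt_trans (le_trans w2 (le_trans z2 yx))); last by lra.
move=> /(_ isT) Hw.
have g1z : g1 z = g2 w * (z - x) by rewrite -w3 g1x subr0.
have E : s * g y - c * (y - x) ^+ 2 = (s * g2 w - 2 * c) * ((z - x) * (y - x)).
  by move: z3; rewrite gx g1z expr2; lra.
rewrite -subr_ge0 E.
apply: mulr_ge0; first by rewrite subr_ge0.
have -> : (z - x) * (y - x) = (z - x) * (y - z) + (z - x) ^+ 2 by ring.
by rewrite addr_ge0// sqr_ge0.
Qed.

End LandauInequality.

(** * Iterates *)

(** With [D] the derivative of [F], this is the chain-rule product for the [n]-th iterate. *)
Definition orbit_prod (R : realType) (F D : R -> R) (n : nat) (x : R) : R :=
  \prod_(k < n) D (iter k F x).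

Section IteratesOfDiffeomorphism.
Variables (R : realType) (F D : R -> R) (m L K : R).
Hypothesis FI : forall x, I01 x -> I01 (F x).
Hypothesis HF : forall x, I01 x -> has_derivI F x (D x).
Hypothesis m0 : 0 < m.
Hypothesis Dge : forall x, I01 x -> m <= D x.
Hypothesis Dle : forall x, I01 x -> D x <= L.
Hypothesis K0 : 0 < K.
Hypothesis Dlip : forall x y, I01 x -> I01 y -> `|D x - D y| <= K * `|x - y|.

Let G x := `|F x - x|.
Let P := orbit_prod F D.

Let D0 x : I01 x -> 0 < D x. Proof. by move=> Ix; rewrite (lt_le_trans m0)// Dge. Qed.

Lemma iter_I01 n x : I01 x -> I01 (iter n F x).
Proof. by move=> Ix; elim: n => //= n; exact: FI. Qed.

Lemma iter_distance_le1 n x : I01 x -> `|iter n F x - x| <= 1.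
Proof.
move=> Ix; have /I01P := iter_I01 n Ix; have /I01P := Ix.
by rewrite ler_norml; lra.
Qed.

Lemma has_derivI_iter n x : I01 x -> has_derivI (iter n F) x (P n x).
Proof.
move=> Ix; rewrite /P /orbit_prod; elim: n => [|n IH]; first by rewrite big_ord0; exact: has_derivI_id.
rewrite big_ord_recr /= mulrC; apply: (@has_derivI_comp _ F (iter n F)) => //.
  by move=> y; exact: iter_I01.
by apply: HF; exact: iter_I01.
Qed.

Lemma orbit_prod_gt0 n x : I01 x -> 0 < P n x.
Proof. by move=> Ix; apply: prodr_gt0 => k _; apply: D0; exact: iter_I01. Qed.

Lemma orbit_prod_bounded n x : I01 x -> P n x <= L ^+ n.
Proof.
move=> Ix; rewrite /P /orbit_prod -[n in L ^+ n]card_ord -prodr_const.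
apply: ler_prod => k _; have Ik := iter_I01 k Ix.
by rewrite Dle// ltW// D0.
Qed.

Lemma orbit_prodS n x : P n.+1 x = D x * P n (F x).
Proof. by rewrite /P /orbit_prod big_ord_recl; congr (_ * _); apply: eq_bigr => k _; rewrite -iterSr. Qed.

(** The mean value theorem from [x] to [F x], kept signed: a positive [D z] preserves the direction
    of motion. *)
Lemma displacement_image x : I01 x -> exists z,
  [/\ I01 z, `|z - x| <= G x & F (F x) - F x = D z * (F x - x)].
Proof.
move=> Ix; have [z [Iz _ z1 z2]] := MVT_I01 HF Ix (FI Ix).
by exists z.
Qed.

(** Since D >= m, log D is Lipschitz with constant [K / m]; the inequality 1 + t <= exp t avoids
    logarithms. *)
Lemma deriv_ratio_le x y : I01 x -> I01 y -> D x <= expR (K / m * `|x - y|) * D y.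
Proof.
move=> Ix Iy; apply: (@le_trans _ _ ((1 + K / m * `|x - y|) * D y)); last first.
  by rewrite ler_wpM2r ?expR_ge1Dx// ltW// D0.
have /ler_normlP[_ h] := Dlip Ix Iy.
have : K * `|x - y| <= K / m * `|x - y| * D y.
  have -> : K / m * `|x - y| * D y = K * `|x - y| * (D y / m) by ring.
  rewrite ler_peMr//; first by rewrite mulr_ge0// ltW.
  by rewrite ler_pdivlMr// mul1r Dge.
by rewrite mulrDl mul1r; lra.
Qed.

(* The displacement is multiplied at each step by the derivative at a point
   close to the orbit; the total error is controlled by the total length of the
   (monotone) orbit. *)
Lemma distortion_signed (s : R) n x : s * s = 1 -> I01 x -> 0 <= s * (F x - x) ->
  P n x * G x <= expR (K / m * (s * (iter n F x - x))) * G (iter n F x) /\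
  G (iter n F x) <= expR (K / m * (s * (iter n F x - x))) * (P n x * G x).
Proof.
move=> s1; elim: n x => [|n IH] x Ix sx.
  by rewrite /P /orbit_prod big_ord0 /= subrr !mulr0 expR0 !mul1r.
have GE : G x = s * (F x - x).
  have : `|s| = 1 by apply/eqP; rewrite -(@eqrXn2 _ 2)// expr1n expr2 -normrM s1 normr1.
  by move=> sn; rewrite -(ger0_norm sx) normrM sn mul1r.
have [z [Iz zx zE]] := displacement_image Ix.
(* The direction [s] persists, so the steps telescope and [s * (iter n F x - x)] is the length of
   the orbit. *)
have sFx : 0 <= s * (F (F x) - F x) by rewrite zE mulrCA mulr_ge0// ltW// D0.
have GFE : G (F x) = D z * G x by rewrite /G zE normrM gtr0_norm ?D0.
have [IH1 IH2] := IH _ (FI Ix) sFx.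
rewrite orbit_prodS iterSr.
set y := iter n F (F x) in IH1 IH2 *.
have eE : expR (K / m * (s * (y - x))) = expR (K / m * G x) * expR (K / m * (s * (y - F x))).
  by rewrite -expRD; congr expR; rewrite GE; ring.
have G0 : 0 <= G x by exact: normr_ge0.
have le_exp : expR (K / m * `|z - x|) <= expR (K / m * G x).
  by rewrite ler_expR ler_wpM2l// divr_ge0// ltW.
have Dxz : D x <= expR (K / m * G x) * D z.
  apply: (le_trans (deriv_ratio_le Ix Iz)); rewrite distrC.
  by apply: ler_wpM2r => //; rewrite ltW// D0.
have Dzx : D z <= expR (K / m * G x) * D x.
  apply: (le_trans (deriv_ratio_le Iz Ix)).
  by apply: ler_wpM2r => //; rewrite ltW// D0.
have P0 := ltW (orbit_prod_gt0 n (FI Ix)).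
rewrite eE; split.
- have -> : D x * P n (F x) * G x = D x * (P n (F x) * G x) by ring.
  apply: (@le_trans _ _ (expR (K / m * G x) * D z * (P n (F x) * G x))).
    by apply: ler_wpM2r => //; rewrite mulr_ge0.
  have -> : expR (K / m * G x) * D z * (P n (F x) * G x) =
      expR (K / m * G x) * (P n (F x) * G (F x)) by rewrite GFE; ring.
  by rewrite -[X in _ <= X]mulrA ler_pM2l ?expR_gt0.
- apply: (le_trans IH2); rewrite GFE.
  have -> : P n (F x) * (D z * G x) = D z * (P n (F x) * G x) by ring.
  rewrite [X in _ <= X * _]mulrC -[X in _ <= X]mulrA ler_pM2l ?expR_gt0//.
  have -> : expR (K / m * G x) * (D x * P n (F x) * G x) =
    expR (K / m * G x) * D x * (P n (F x) * G x) by ring.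
  by apply: ler_wpM2r => //; rewrite mulr_ge0.
Qed.

(** A monotone orbit in [0, 1] has length at most 1, which makes the constant uniform in [n] and
    [x]. *)
Lemma distortion n x : I01 x ->
  P n x * G x <= expR (K / m) * G (iter n F x) /\
  G (iter n F x) <= expR (K / m) * (P n x * G x).
Proof.
move=> Ix; have [s [s1 s2 s3]] : exists s : R, [/\ `|s| = 1, s * s = 1 & 0 <= s * (F x - x)].
  have [h|/ltW h] := leP 0 (F x - x); first by exists 1; rewrite normr1 !mul1r.
  by exists (-1); rewrite normrN normr1 mulN1r opprK mulN1r oppr_ge0.
have [h1 h2] := distortion_signed n s2 Ix s3.
have e1 : expR (K / m * (s * (iter n F x - x))) <= expR (K / m).
  rewrite ler_expR ler_piMr ?divr_ge0 ?(ltW m0) ?(ltW K0)//.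
  by rewrite (le_trans (ler_norm _))// normrM s1 mul1r iter_distance_le1.
split; [apply: (le_trans h1)|apply: (le_trans h2)]; apply: ler_wpM2r => //.
  exact: normr_ge0.
by rewrite mulr_ge0 ?(ltW (orbit_prod_gt0 _ _))// normr_ge0.
Qed.

(** * Upper bound for the derivative of iterates *)

Section Upper.
Variables (b eta : R).
Hypothesis b0 : 0 <= b.
Hypothesis eta0 : 0 < eta.
Hypothesis Deta : forall x, I01 x -> G x < eta -> `|D x - 1| <= b * Num.sqrt (G x).

(** Bounds G z / G x when |z - x| <= G x: [L] comes from |F z - F x|, and 2 from |F x - x| + |z -
    x|. *)
Let c := L + 2.
Let s x := Num.sqrt (G x).

Let c1 : 1 <= c.
Proof.
have I0 : I01 (0 : R) by apply/I01P; rewrite lexx ler01.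
have := Dle I0; have := Dge I0; rewrite /c; move: m0; lra.
Qed.

(** Since G (F x) = D z * G x with D z <= 1 + b * c * s x, also s (F x) <= s x * (1 + b * c * s x).
    Dividing settles the case where [s] grows; otherwise 1 / s does not decrease. *)
Lemma inv_sqrt_displacement_step x : I01 x -> 0 < G x -> c * G x < eta ->
  (s x)^-1 <= (s (F x))^-1 + b * c.
Proof.
move=> Ix Gx cGx; have [z [Iz zx zE]] := displacement_image Ix.
have cc := c1.
have sx0 : 0 < s x by rewrite sqrtr_gt0.
have GFE : G (F x) = D z * G x by rewrite /G zE normrM gtr0_norm ?D0.
have s2 : s x ^+ 2 = G x by rewrite sqr_sqrtr// ltW.
have sFx0 : 0 < s (F x) by rewrite sqrtr_gt0 GFE mulr_gt0// D0.
have Gz : G z <= c * G x.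
  have [w [Iw _ _ wE]] := MVT_I01 HF Ix Iz.
  have h1 : `|F z - F x| <= L * G x.
    by rewrite wE normrM gtr0_norm ?D0// ler_pM// ?Dle// ltW// D0.
  have -> : G z = `|(F z - F x) + ((F x - x) - (z - x))|.
    by rewrite /G; congr `|_|; ring.
  apply: (le_trans (ler_normD _ _)); apply: (@le_trans _ _ (L * G x + (G x + G x))).
    by apply: lerD => //; apply: (le_trans (ler_normB _ _)); exact: lerD.
  by rewrite /c; lra.
have sz : s z <= c * s x.
  have -> : c * s x = Num.sqrt ((c * s x) ^+ 2).
    by rewrite sqrtr_sqr ger0_norm// mulr_ge0// ltW// (lt_le_trans ltr01).
  apply: ler_wsqrtr; apply: (le_trans Gz); rewrite exprMn s2.
  by rewrite ler_wpM2r ?(ltW Gx)// expr2 ler_peMl// (le_trans ler01).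
have /ler_normlP[_ Dz] := Deta Iz (le_lt_trans Gz cGx).
have Dz' : D z <= 1 + b * c * s x.
  have : b * s z <= b * (c * s x) by exact: ler_wpM2l.
  by move: Dz; rewrite /s; lra.
have bc0 : 0 <= b * c by rewrite mulr_ge0// (le_trans ler01).
have [sle|sge] := leP (s (F x)) (s x).
  by rewrite (le_trans (_ : _ <= (s (F x))^-1))// ?lef_pV2 ?lerDl.
have sF : s (F x) <= s x * (1 + b * c * s x).
  have t0 : 0 <= b * c * s x by rewrite mulr_ge0// ltW.
  have h1 : 0 <= 1 + b * c * s x by rewrite addr_ge0.
  have -> : s x * (1 + b * c * s x) = Num.sqrt ((s x * (1 + b * c * s x)) ^+ 2).
    by rewrite sqrtr_sqr ger0_norm// mulr_ge0// ltW.
  apply: ler_wsqrtr; rewrite GFE exprMn s2 mulrC.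
  rewrite ler_pM2l// (le_trans Dz')// expr2 ler_peMl// lerDl.
  exact: t0.
have E : (s (F x))^-1 + b * c - (s x)^-1 = (s x + b * c * s x * s (F x) - s (F x)) / (s x * s (F x)).
  by field; rewrite !gt_eqF.
rewrite -subr_ge0 E divr_ge0 ?mulr_ge0 ?(ltW sx0) ?(ltW sFx0)//.
have : b * c * s x * s x <= b * c * s x * s (F x).
  by rewrite ler_wpM2l ?(ltW sge)// mulr_ge0// ltW.
by move: sF; lra.
Qed.

(** The induction peels off the first step and stops once [c * G x] reaches [eta]: then 1 / s x is
    at most the middle term, whatever the rest of the orbit does. *)
Lemma inv_sqrt_displacement_iter n x : I01 x -> 0 < G x ->
  (s x)^-1 <= (s (iter n F x))^-1 + (Num.sqrt (eta / c))^-1 + n%:R * (b * c).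
Proof.
have c0 : 0 < c by rewrite (lt_le_trans ltr01).
have bc0 : 0 <= b * c by rewrite mulr_ge0// ltW.
elim: n x => [|n IH] x Ix Gx.
  by rewrite mul0r addr0 lerDl invr_ge0 sqrtr_ge0.
have [small|big] := ltP (c * G x) eta; last first.
  apply: (@le_trans _ _ (Num.sqrt (eta / c))^-1).
    rewrite lef_pV2 ?posrE ?sqrtr_gt0 ?divr_gt0//.
    by apply: ler_wsqrtr; rewrite ler_pdivrMr// mulrC.
  have h1 : 0 <= n.+1%:R * (b * c) by rewrite mulr_ge0.
  have h2 : 0 <= (s (iter n.+1 F x))^-1 by rewrite invr_ge0 sqrtr_ge0.
  by rewrite addrAC lerDr addr_ge0.
have [z [Iz zx zE]] := displacement_image Ix.
have GFE : G (F x) = D z * G x by rewrite /G zE normrM gtr0_norm ?D0.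
have GF0 : 0 < G (F x) by rewrite GFE mulr_gt0// D0.
apply: (le_trans (inv_sqrt_displacement_step Ix Gx small)).
rewrite iterSr; have := IH _ (FI Ix) GF0.
rewrite -(natr1 n) mulrDl mul1r; lra.
Qed.

(** By [distortion], it suffices to bound the ratio of [s] at the [n]-th iterate to [s x].
    Multiplying the preceding bound on 1 / s x by the former, which is at most 1, does this. *)
Lemma orbit_prod_le n x : I01 x ->
  P n x <= expR (K / m) * (1 + (Num.sqrt (eta / c))^-1 + n%:R * (b * c)) ^+ 2.
Proof.
move=> Ix; set A := (Num.sqrt _)^-1; set Q := 1 + A + _.
have A0 : 0 <= A by rewrite invr_ge0 sqrtr_ge0.
have c0 : 0 < c by rewrite (lt_le_trans ltr01).
have nbc0 : 0 <= n%:R * (b * c) by rewrite !mulr_ge0// ltW.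
have Q1 : 1 <= Q by rewrite /Q -addrA lerDl addr_ge0.
have Km : 0 <= K / m by rewrite divr_ge0// ltW.
(* At a fixed point no ratio can be formed, but [Deta] forces [D x = 1]. *)
have [Gx|Gx] := eqVneq (G x) 0.
  have Fx : F x = x by apply/eqP; rewrite -subr_eq0 -normr_eq0 -/(G x) Gx.
  have Dx : D x = 1.
    have := Deta Ix; rewrite Gx sqrtr0 mulr0 => /(_ eta0).
    by rewrite normr_le0 subr_eq0 => /eqP.
  have -> : P n x = 1.
    by rewrite /P /orbit_prod big1// => k _; rewrite iter_fix.
  rewrite -[1]mulr1; apply: ler_pM => //.
    by rewrite -expR0 ler_expR.
  by rewrite expr2 mulr_ege1.
have G0 : 0 < G x by rewrite lt0r Gx normr_ge0.
have s0 : 0 < s x by rewrite sqrtr_gt0.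
have [h _] := distortion n Ix.
rewrite -(ler_pM2r G0); apply: (le_trans h); rewrite -mulrA ler_pM2l ?expR_gt0//.
have -> : Q ^+ 2 * G x = (Q * s x) ^+ 2 by rewrite exprMn sqr_sqrtr// ltW.
have -> : G (iter n F x) = s (iter n F x) ^+ 2 by rewrite sqr_sqrtr// normr_ge0.
have sn0 : 0 <= s (iter n F x) by exact: sqrtr_ge0.
have Q0 : 0 <= Q by rewrite (le_trans ler01).
rewrite ler_pXn2r ?nnegrE ?(mulr_ge0 Q0 (ltW s0))//.
move: sn0; rewrite le_eqVlt => /orP[/eqP <-|sn0]; first by rewrite (mulr_ge0 Q0 (ltW s0)).
have sn1 : s (iter n F x) <= 1.
  rewrite -sqrtr1; apply: ler_wsqrtr.
  by apply: (iter_distance_le1 1); exact: iter_I01.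
have := inv_sqrt_displacement_iter n Ix G0; rewrite -/A => H.
have H2 : s (iter n F x) / s x <= Q.
  apply: (le_trans (ler_wpM2l (ltW sn0) H)).
  rewrite /Q -addrA mulrDr mulfV ?gt_eqF// -addrA lerD2l.
  by apply: ler_piMl => //; rewrite addr_ge0.
by rewrite -ler_pdivrMr.
Qed.

End Upper.

(** * Lower bound along an orbit attracted to a fixed point *)

Section Lower.
Variables (H : R -> R) (a x0 tau r c : R).
Hypothesis HI : forall x, I01 x -> I01 (H x).
Hypothesis FH : forall x, I01 x -> F (H x) = x.
Hypothesis HFK : forall x, I01 x -> H (F x) = x.
Hypothesis Hmono : forall x y, I01 x -> I01 y -> x <= y -> H x <= H y.
Hypotheses (Ia : I01 a) (Ix0 : I01 x0) (Ha : H a = a) (Da : D a = 1).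
Hypothesis tau1 : tau * tau = 1.
Hypothesis c0 : 0 < c.
Hypothesis x0a : 0 < tau * (a - x0) <= r.
Hypothesis Hquad : forall x, I01 x -> `|x - a| <= r -> c * (x - a) ^+ 2 <= tau * (H x - x).

Let ntau : `|tau| = 1.
Proof. by apply/eqP; rewrite -(@eqrXn2 _ 2)// expr1n expr2 -normrM tau1 normr1. Qed.

(** [tau] is the direction from [x0] to [a], and also that in which [H] moves points near [a]; a
    monotone [H] fixing [a] cannot carry them past it. *)
Let Hmono' x : I01 x -> 0 <= tau * (a - x) -> 0 <= tau * (a - H x).
Proof.
move=> Ix; rewrite -{2}Ha; have [t0|t0] := ltP 0 tau.
  by rewrite !pmulr_rge0// !subr_ge0; exact: Hmono.
have t0' : tau < 0.
  by rewrite lt_neqAle t0 andbT; apply/eqP => t; move: tau1; rewrite t mul0r => /eqP; rewrite eq_sym oner_eq0.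
by rewrite !nmulr_rge0// !subr_le0; exact: Hmono.
Qed.

Lemma iter_inverse_I01 n : I01 (iter n H x0).
Proof. by elim: n => //= n; exact: HI. Qed.

(** Discrete form of d' = - c d^2. With e = c d <= 1, the bound n e <= 1 yields (n + 1) (e - e^2) <=
    (1 + e) (1 - e) <= 1; for e > 1 the left side is negative. *)
Lemma quadratic_approach n : 0 <= tau * (a - iter n H x0) <= r /\
  n%:R * (c * (tau * (a - iter n H x0))) <= 1.
Proof.
elim: n => [|n [/andP[IH1 IH2] IH3]].
  by have /andP[h1 h2] := x0a; rewrite mul0r ler01 ltW.
have In := iter_inverse_I01 n.
rewrite iterS; set x := iter n H x0 in IH1 IH2 IH3 In *; set d := tau * (a - x) in IH1 IH2 IH3.
have d'0 := Hmono' In IH1.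
have xa : (x - a) ^+ 2 = d ^+ 2 by rewrite exprMn [tau ^+ 2]expr2 tau1 mul1r -sqrrN opprB.
have nxa : `|x - a| = d by rewrite -(ger0_norm IH1) normrM ntau mul1r distrC.
have := Hquad In; rewrite xa nxa => /(_ IH2) h.
have E : tau * (a - H x) = d - tau * (H x - x) by rewrite /d; ring.
have d'le : tau * (a - H x) <= d - c * d ^+ 2 by rewrite E; lra.
have cd2 : 0 <= c * d ^+ 2 by rewrite mulr_ge0 ?sqr_ge0// ltW.
split; first by rewrite d'0 /=; lra.
have n0 : 0 <= n.+1%:R * c by rewrite mulr_ge0// ltW.
have := ler_wpM2l n0 d'le; rewrite -mulrA => /le_trans; apply.
set e := c * d in IH3; have e0 : 0 <= e by rewrite mulr_ge0// ltW.
have -> : n.+1%:R * c * (d - c * d ^+ 2) = (n%:R * e + e) * (1 - e).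
  by rewrite /e -natr1; ring.
have [e1|e1] := leP e 1.
  apply: (@le_trans _ _ ((1 + e) * (1 - e))); first by rewrite ler_wpM2r ?subr_ge0// lerD2r.
  by have := sqr_ge0 e; rewrite expr2; lra.
apply: (le_trans _ ler01); apply: mulr_ge0_le0; last by rewrite subr_le0 ltW.
by rewrite addr_ge0// mulr_ge0.
Qed.

(** [F] is tangent to the identity at [a]: the mean value theorem gives one factor |x - a|, and the
    Lipschitz bound on [D] the other. *)
Lemma displacement_quadratic x : I01 x -> G x <= K * (x - a) ^+ 2.
Proof.
move=> Ix; have [z [Iz _ z1 z2]] := MVT_I01 HF Ia Ix.
have Fa : F a = a by rewrite -[in LHS]Ha FH.
have -> : G x = `|D z - D a| * `|x - a|.
  by rewrite -normrM Da mulrBl mul1r -z2 Fa /G; congr `|_|; ring.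
have -> : (x - a) ^+ 2 = `|x - a| * `|x - a| by rewrite -normrM -expr2 ger0_norm ?sqr_ge0.
rewrite mulrA; apply: ler_wpM2r; first exact: normr_ge0.
by apply: (le_trans (Dlip Iz Ia)); rewrite ler_wpM2l// ltW.
Qed.

(* The point [y] is the [n]-th iterate of [x0] under the inverse map, so the
   displacement grows from O(1 / n ^+ 2) at [y] to a fixed value at [x0]. *)
Lemma orbit_prod_ge : exists2 k : R, 0 < k &
  forall n, (1 <= n)%N -> exists2 y, I01 y & k * n%:R ^+ 2 <= P n y.
Proof.
(* If [x0] were fixed, its displacement under [H] would vanish, against [Hquad]. *)
have Gx0 : 0 < G x0.
  rewrite normr_gt0 subr_eq0; apply/eqP => Fx0.
  have Hx0 : H x0 = x0 by rewrite -[in LHS]Fx0 HFK.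
  have /andP[h1 h2] := x0a.
  have nx : `|x0 - a| = tau * (a - x0).
    by rewrite -(gtr0_norm h1) normrM ntau mul1r distrC.
  have sq : 0 < (x0 - a) ^+ 2 by rewrite -[_ ^+ 2]ger0_norm ?sqr_ge0// normrX nx exprn_gt0.
  have := Hquad Ix0; rewrite nx => /(_ h2).
  by rewrite Hx0 subrr mulr0 leNgt mulr_gt0.
(* From G x0 <= expR (K / m) * P n y * K * d ^ 2 and (n * c * d) ^ 2 <= 1, with d = |y - a|. *)
exists (G x0 * c ^+ 2 / (expR (K / m) * K)).
  by rewrite divr_gt0 ?mulr_gt0 ?expR_gt0// exprn_gt0.
move=> n n1; exists (iter n H x0); first exact: iter_inverse_I01.
have In := iter_inverse_I01 n.
have [_] := distortion n In.
have -> : iter n F (iter n H x0) = x0.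
  by elim: n {n1 In} => // n IH; rewrite iterSr iterS FH//; exact: iter_inverse_I01.
set p := P n _ => h.
have p0 : 0 <= p by rewrite ltW// orbit_prod_gt0.
have [/andP[d0 _] dn] := quadratic_approach n.
set d := tau * _ in d0 dn.
have Gd : G (iter n H x0) <= K * d ^+ 2.
  apply: (le_trans (displacement_quadratic In)).
  by rewrite /d exprMn [tau ^+ 2]expr2 tau1 mul1r -sqrrN opprB.
have e0 := expR_gt0 (K / m).
rewrite mulrAC ler_pdivrMr ?mulr_gt0//.
apply: (@le_trans _ _ (expR (K / m) * (p * (K * d ^+ 2)) * c ^+ 2 * n%:R ^+ 2)).
  rewrite ler_wpM2r ?sqr_ge0// ler_wpM2r ?sqr_ge0//.
  by apply: (le_trans h); rewrite ler_pM2l// ler_wpM2l.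
have -> : expR (K / m) * (p * (K * d ^+ 2)) * c ^+ 2 * n%:R ^+ 2 =
  p * (expR (K / m) * K) * (n%:R * (c * d)) ^+ 2 by ring.
have t0 : 0 <= n%:R * (c * d) by rewrite mulr_ge0// mulr_ge0// ltW.
have pEK : 0 <= p * (expR (K / m) * K) by rewrite mulr_ge0// mulr_ge0// ltW.
by apply: ler_piMr => //; rewrite expr2 mulr_ile1.
Qed.

End Lower.

End IteratesOfDiffeomorphism.

(** * A diffeomorphism and its inverse *)

Section InversePair.
Variables (R : realType) (f h : R -> R).
Hypothesis fI : forall x, I01 x -> I01 (f x).
Hypothesis hI : forall x, I01 x -> I01 (h x).
Hypothesis fK : forall x, I01 x -> h (f x) = x.
Hypothesis hK : forall x, I01 x -> f (h x) = x.
Hypotheses (fC2 : C2I f) (hC2 : C2I h).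
Hypotheses (f0 : f 0 = 0) (f1 : f 1 = 1).

Lemma C2I_has_derivI (g : R -> R) x : C2I g -> I01 x -> has_derivI g x (derivI g x).
Proof. by case=> H _ _ Ix; apply: derivableI_has_derivI; exact: H. Qed.

Lemma C2I_has_derivI2 (g : R -> R) x : C2I g -> I01 x ->
  has_derivI (derivI g) x (derivI (derivI g) x).
Proof. by case=> _ H _ Ix; apply: derivableI_has_derivI; exact: H. Qed.

Lemma deriv_inverse x : I01 x -> derivI h (f x) * derivI f x = 1.
Proof.
move=> Ix; have C : has_derivI (h \o f) x (derivI h (f x) * derivI f x).
  by apply: has_derivI_comp => //; apply: C2I_has_derivI => //; exact: fI.
have := has_derivI_unique Ix C => <-.
apply: has_derivI_unique => //.
apply: (eq_has_derivI _ Ix (has_derivI_id x)) => y Iy /=.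
by rewrite fK.
Qed.

(** By [deriv_inverse] the derivative never vanishes, and the mean value theorem on [0, 1] gives it
    the value 1 somewhere; the intermediate value theorem fixes its sign. *)
Lemma deriv_gt0 x : I01 x -> 0 < derivI f x.
Proof.
move=> Ix; have nz y : I01 y -> derivI f y != 0.
  move=> Iy; apply/eqP => fy; have := deriv_inverse Iy.
  by rewrite fy mulr0 => /eqP; rewrite eq_sym oner_eq0.
have I0 : I01 (0 : R) by apply/I01P; rewrite lexx ler01.
have I1 : I01 (1 : R) by apply/I01P; rewrite lexx ler01.
have [c [Ic _ _]] := MVT_I01 (fun x => C2I_has_derivI fC2) I0 I1.
rewrite f0 f1 subr0 mulr1 => fc; rewrite ltNge; apply/negP => fx.
have fc' a b : 0 <= a -> b <= 1 -> {within `[a, b], continuous (derivI f)}.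
  by apply: has_derivI_continuous; exact: (fun x => C2I_has_derivI2 fC2).
have /andP[x0 x1] := (I01P x).1 Ix; have /andP[c0 c1] := (I01P c).1 Ic.
have [xc|/ltW cx] := leP x c.
  have [|z] := @IVT _ _ x c 0 xc (fc' _ _ x0 c1).
    by rewrite ge_min le_max fx -fc ler01 orbT.
  rewrite in_itv/= => /andP[xz zc] /eqP; apply/negP/nz.
  by apply/I01P; lra.
have [|z] := @IVT _ _ c x 0 cx (fc' _ _ c0 x1).
  by rewrite ge_min le_max fx -fc ler01 orbT.
rewrite in_itv/= => /andP[xz zc] /eqP; apply/negP/nz.
by apply/I01P; lra.
Qed.

Lemma diffeo_increasing x y : I01 x -> I01 y -> x <= y -> f x <= f y.
Proof.
move=> Ix Iy xy; have [c [Ic _ _ cE]] := MVT_I01 (fun x => C2I_has_derivI fC2) Ix Iy.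
by rewrite -subr_ge0 cE mulr_ge0 ?subr_ge0// ltW// deriv_gt0.
Qed.

Lemma diffeo_bounds : exists m L K : R, [/\ 0 < m, 0 < K,
  forall x, I01 x -> m <= derivI f x, forall x, I01 x -> derivI f x <= L &
  forall x y, I01 x -> I01 y -> `|derivI f x - derivI f y| <= K * `|x - y| ].
Proof.
have fc (g : R -> R) : C2I g -> {within @I01 R, continuous (derivI g)}.
  move=> gC2; apply: (@has_derivI_continuous _ _ (derivI (derivI g)) 0 1) => // x.
  exact: C2I_has_derivI2.
have [L L0 HL] := within_I01_bounded (fc _ fC2).
have [M M0 HM] := within_I01_bounded (fc _ hC2).
have [_ _ f2c] := fC2; have [K K0 HK] := within_I01_bounded f2c.
(* The lower bound comes from f' (x) = 1 / h' (f x); adding 1 ensures positivity. *)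
exists (M + 1)^-1, L, (K + 1); split.
- by rewrite invr_gt0 ltr_wpDl.
- by rewrite ltr_wpDl.
- move=> x Ix; have fx := deriv_gt0 Ix.
  rewrite -[leLHS]mul1r ler_pdivrMr ?ltr_wpDl// mulrC.
  rewrite -[leLHS](deriv_inverse Ix) ler_pM2r//.
  by rewrite (le_trans (ler_norm _))// (le_trans (HM _ (fI Ix)))// lerDl.
- by move=> x Ix; rewrite (le_trans (ler_norm _))// HL.
- move=> x y Ix Iy.
  have [c [Ic _ _ ->]] := MVT_I01 (fun x => C2I_has_derivI2 fC2) Iy Ix.
  rewrite normrM; apply: ler_wpM2r; first exact: normr_ge0.
  by rewrite (le_trans (HK _ Ic))// lerDl.
Qed.

Lemma derivI_iter n x : I01 x -> derivI (iter n f) x = orbit_prod f (derivI f) n x.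
Proof.
move=> Ix; apply: has_derivI_unique => //.
by apply: has_derivI_iter => // y; exact: C2I_has_derivI.
Qed.

Lemma orbit_prod_deriv_gt0 n x : I01 x -> 0 < orbit_prod f (derivI f) n x.
Proof. by have [m [L [K [m0 _ Hm _ _]]]] := diffeo_bounds; exact: (orbit_prod_gt0 _ m0). Qed.

Lemma max_deriv_le n (M : R) : (forall x, I01 x -> orbit_prod f (derivI f) n x <= M) ->
  max_deriv (iter n f) <= M.
Proof.
move=> HM; apply: ge_sup => [|_ [x Ix <-]].
  by exists `|derivI (iter n f) 0|; exists 0 => //; apply/I01P; rewrite lexx ler01.
by rewrite derivI_iter// gtr0_norm ?HM// orbit_prod_deriv_gt0.
Qed.

Lemma max_deriv_ge n x : I01 x -> orbit_prod f (derivI f) n x <= max_deriv (iter n f).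
Proof.
move=> Ix; have [m [L [K [m0 _ Hm HL _]]]] := diffeo_bounds.
apply: ub_le_sup; last first.
  by exists x => //; rewrite derivI_iter// gtr0_norm// orbit_prod_deriv_gt0.
(* The supremum dominates its set only once that set is known to be bounded; a crude bound for each
   [n] suffices. *)
exists (L ^+ n) => _ [y Iy <-].
rewrite derivI_iter// gtr0_norm ?orbit_prod_deriv_gt0//.
exact: (orbit_prod_bounded _ m0 Hm).
Qed.

(** The order of quantifiers matters: [C] precedes [b] and [eta], and only [A] may depend on them,
    so a small [b] gives a small coefficient of n^2. *)
Lemma max_deriv_upper : exists2 C : R, 0 < C & forall b eta : R, 0 <= b -> 0 < eta ->
  (forall x, I01 x -> `|f x - x| < eta -> `|derivI f x - 1| <= b * Num.sqrt `|f x - x|) ->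
  exists2 A : R, 0 <= A & forall n, max_deriv (iter n f) <= C * (A + n%:R * (b * C)) ^+ 2.
Proof.
have [m [L [K [m0 K0 Hm HL HK]]]] := diffeo_bounds.
have L0 : 0 < L + 2.
  have I0 : I01 (0 : R) by apply/I01P; rewrite lexx ler01.
  by have := HL _ I0; have := Hm _ I0; move: m0; lra.
have e0 := expR_gt0 (K / m).
exists (expR (K / m) + (L + 2)); first by rewrite addr_gt0.
move=> b eta b0 eta0 Hb; exists (1 + (Num.sqrt (eta / (L + 2)))^-1).
  by rewrite addr_ge0// invr_ge0 sqrtr_ge0.
move=> n; apply: max_deriv_le => x Ix.
apply: (le_trans (orbit_prod_le fI (fun x => C2I_has_derivI fC2) m0 Hm HL K0 HK b0 eta0 Hb n Ix)).
have A0 : 0 <= (Num.sqrt (eta / (L + 2)))^-1 by rewrite invr_ge0 sqrtr_ge0.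
have nb0 : 0 <= n%:R * (b * (L + 2)) by rewrite !mulr_ge0// ltW.
have nb1 : n%:R * (b * (L + 2)) <= n%:R * (b * (expR (K / m) + (L + 2))).
  by rewrite ler_wpM2l// ler_wpM2l// lerDr ltW.
apply: ler_pM; rewrite ?sqr_ge0 ?(ltW e0)// ?lerDl ?(ltW L0)//.
by rewrite ler_pXn2r ?nnegrE ?lerD2l// !addr_ge0// (le_trans nb0).
Qed.

(** With x = h y the two displacements have equal size, and h' (y) - 1 = - h' (y) * (f' (x) - 1);
    [M] bounds |h'|. *)
Lemma inverse_near_one : exists2 M : R, 0 <= M & forall b eta : R, 0 <= b ->
  (forall x, I01 x -> `|f x - x| < eta -> `|derivI f x - 1| <= b * Num.sqrt `|f x - x|) ->
  forall y, I01 y -> `|h y - y| < eta ->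
    `|derivI h y - 1| <= M * b * Num.sqrt `|h y - y|.
Proof.
have h1c : {within @I01 R, continuous (derivI h)}.
  apply: (@has_derivI_continuous _ _ (derivI (derivI h)) 0 1) => // x.
  exact: C2I_has_derivI2.
have [M M0 HM] := within_I01_bounded h1c.
exists M => // b eta b0 Hb y Iy hy.
have hE : `|f (h y) - h y| = `|h y - y| by rewrite hK// distrC.
have := Hb _ (hI Iy); rewrite hE => /(_ hy) H.
have := deriv_inverse (hI Iy); rewrite hK// => E.
have -> : derivI h y - 1 = - (derivI h y * (derivI f (h y) - 1)).
  by rewrite mulrBr E; ring.
by rewrite normrN normrM -mulrA; apply: ler_pM => //; exact: HM.
Qed.

Hypothesis parabolic : forall x, I01 x -> f x = x -> derivI f x = 1.

(** Landau's inequality for [f y - y] after square roots, with 2 in place of the square root of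
    2. *)
Lemma deriv_near_one (B eta : R) : 0 <= B ->
  (forall y, I01 y -> `|f y - y| < eta -> `|derivI (derivI f) y| <= B) ->
  forall x, I01 x -> `|f x - x| < eta ->
  `|derivI f x - 1| <= 2 * Num.sqrt B * Num.sqrt `|f x - x|.
Proof.
move=> B0 HB x Ix fx.
have := @landau_ineq _ (fun y => f y - y) (fun y => derivI f y - 1)
  (derivI (derivI f)) B eta x _ _ _ _ _ HB.
have Hg y : I01 y -> has_derivI (fun y => f y - y) y (derivI f y - 1).
  by move=> Iy; apply: has_derivIB; [exact: C2I_has_derivI | exact: has_derivI_id].
have Hg1 y : I01 y -> has_derivI (fun y => derivI f y - 1) y (derivI (derivI f) y).
  move=> Iy; rewrite -[derivI (derivI f) y]subr0.
  by apply: has_derivIB; [exact: C2I_has_derivI2 | exact: has_derivI_cst].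
have gz y : I01 y -> f y - y = 0 -> derivI f y - 1 = 0.
  by move=> Iy /eqP; rewrite subr_eq0 => /eqP /parabolic ->//; rewrite subrr.
move=> /(_ Hg Hg1 gz); rewrite f0 f1 !subrr => /(_ erefl erefl Ix fx) H.
have -> : 2 * Num.sqrt B * Num.sqrt `|f x - x| =
    Num.sqrt ((2 * Num.sqrt B * Num.sqrt `|f x - x|) ^+ 2).
  by rewrite sqrtr_sqr [RHS]ger0_norm// !mulr_ge0// sqrtr_ge0.
rewrite -sqrtr_sqr; apply: ler_wsqrtr; apply: (le_trans H).
rewrite !exprMn !sqr_sqrtr//.
have : 0 <= B * `|f x - x| by rewrite mulr_ge0// normr_ge0.
by rewrite expr2; lra.
Qed.

End InversePair.

(** * Growth *)

Section GrowthOfInversePair.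
Variables (R : realType) (f h : R -> R).
Hypothesis fI : forall x, I01 x -> I01 (f x).
Hypothesis hI : forall x, I01 x -> I01 (h x).
Hypothesis fK : forall x, I01 x -> h (f x) = x.
Hypothesis hK : forall x, I01 x -> f (h x) = x.
Hypotheses (fC2 : C2I f) (hC2 : C2I h).
Hypotheses (f0 : f 0 = 0) (f1 : f 1 = 1).
Hypothesis parabolic : forall x, I01 x -> f x = x -> derivI f x = 1.

Let growth_pair n := Num.max (max_deriv (iter n f)) (max_deriv (iter n h)).

Let h0 : h 0 = 0.
Proof. by rewrite -[in LHS]f0 fK//; apply/I01P; rewrite lexx ler01. Qed.

Let h1 : h 1 = 1.
Proof. by rewrite -[in LHS]f1 fK//; apply/I01P; rewrite lexx ler01. Qed.

(** Landau's inequality is applied to [f] only; [inverse_near_one] carries the resulting estimate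
    over to [h]. *)
Lemma growth_upper : exists2 C : R, 0 < C & forall B eta : R, 0 <= B -> 0 < eta ->
  (forall y, I01 y -> `|f y - y| < eta -> `|derivI (derivI f) y| <= B) ->
  exists2 A : R, 0 <= A & forall n, growth_pair n <= C * (A + n%:R * (Num.sqrt B * C)) ^+ 2.
Proof.
have [Cf Cf0 Hf] := max_deriv_upper fI fK fC2 hC2 f0 f1.
have [Ch Ch0 Hh] := max_deriv_upper hI hK hC2 fC2 h0 h1.
have [M M0 HM] := inverse_near_one fI hI fK hK fC2 hC2.
(* Dominates [Cf], [Ch] and the coefficients 2 * Cf and 2 * M * Ch of the square root of [B]. *)
pose C := 2 * Cf + (2 * M + 1) * Ch.
have MCh : 0 <= M * Ch by rewrite mulr_ge0// ltW.
exists C; first by rewrite /C; lra.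
move=> B eta B0 eta0 HB.
have sB := sqrtr_ge0 B.
have b0 : 0 <= 2 * Num.sqrt B by rewrite mulr_ge0.
have near_f := deriv_near_one fC2 f0 f1 parabolic B0 HB.
have near_h := HM _ _ b0 near_f.
have [Af Af0 HAf] := Hf _ _ b0 eta0 near_f.
have [Ah Ah0 HAh] := Hh _ _ (mulr_ge0 M0 b0) eta0 near_h.
exists (Af + Ah); first exact: addr_ge0.
have mono (c a d n : R) : 0 <= c <= C -> 0 <= a <= Af + Ah -> 0 <= n -> 0 <= d <= Num.sqrt B * C ->
    c * (a + n * d) ^+ 2 <= C * (Af + Ah + n * (Num.sqrt B * C)) ^+ 2.
  move=> /andP[c0 cC] /andP[a0 aA] n0 /andP[d0 dC].
  apply: ler_pM => //; first exact: sqr_ge0.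
  have ? : a + n * d <= Af + Ah + n * (Num.sqrt B * C).
    by apply: lerD => //; exact: ler_wpM2l.
  have ? : 0 <= a + n * d by rewrite addr_ge0// mulr_ge0.
  by rewrite ler_pXn2r ?nnegrE// (le_trans _ (_ : a + n * d <= _)).
move=> n; rewrite /growth_pair ge_max; apply/andP; split.
- apply: (le_trans (HAf n)); apply: mono => //.
  + by rewrite ltW//= /C; lra.
  + by rewrite Af0 lerDl.
  + rewrite mulr_ge0 ?(ltW Cf0)//=.
    have -> : 2 * Num.sqrt B * Cf = Num.sqrt B * (2 * Cf) by ring.
    by rewrite ler_wpM2l// /C; lra.
- apply: (le_trans (HAh n)); apply: mono => //.
  + by rewrite ltW//= /C; lra.
  + by rewrite Ah0 lerDr.
  + rewrite !mulr_ge0 ?(ltW Ch0)//=.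
    have -> : M * (2 * Num.sqrt B) * Ch = Num.sqrt B * (2 * (M * Ch)) by ring.
    by rewrite ler_wpM2l// /C; lra.
Qed.

Lemma growth_gt0 n : 0 < growth_pair n.
Proof.
have I0 : I01 (0 : R) by apply/I01P; rewrite lexx ler01.
rewrite /growth_pair lt_max; apply/orP; left.
apply: lt_le_trans (max_deriv_ge fI fK fC2 hC2 f0 f1 n I0).
exact: (orbit_prod_deriv_gt0 fI fK fC2 hC2 f0 f1).
Qed.

(** The hypothesis is applied at [h y], which [f] displaces by [y - h y]. Since |h y - a| lies
    between m |y - a| and L |y - a|, the radius becomes r / L and the constant c m^2. *)
Lemma inverse_quadratic_growth a (s r c : R) : 0 < r -> 0 < c -> I01 a -> f a = a ->
  (forall y, I01 y -> `|y - a| <= r -> c * (y - a) ^+ 2 <= s * (f y - y)) ->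
  exists r' c' : R, [/\ 0 < r', 0 < c' & forall y, I01 y -> `|y - a| <= r' ->
    c' * (y - a) ^+ 2 <= - s * (h y - y)].
Proof.
move=> r0 c0 Ia fa Hq.
have [m [L [K [m0 _ Hm HL _]]]] := diffeo_bounds hI hK hC2 fC2 h0 h1.
have L0 : 0 < L by rewrite (lt_le_trans m0)// (le_trans (Hm _ Ia))// HL.
have ha : h a = a by rewrite -[in LHS]fa fK.
exists (r / L), (c * m ^+ 2); split; rewrite ?divr_gt0 ?mulr_gt0 ?exprn_gt0//.
move=> y Iy ya; have [z [Iz _ _]] := MVT_I01 (fun x => C2I_has_derivI hC2) Ia Iy.
rewrite ha => zE; have Dz0 := lt_le_trans m0 (Hm _ Iz).
have := Hq _ (hI Iy); rewrite hK//.
have hyr : `|h y - a| <= r.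
  rewrite zE normrM gtr0_norm//; move: ya; rewrite ler_pdivlMr// mulrC; apply: le_trans.
  by apply: ler_wpM2r; [exact: normr_ge0 | exact: HL].
move=> /(_ hyr) H.
have -> : - s * (h y - y) = s * (y - h y) by ring.
apply: (le_trans _ H); rewrite -mulrA ler_pM2l// zE exprMn.
apply: ler_wpM2r; first exact: sqr_ge0.
by rewrite ler_pXn2r ?nnegrE ?(ltW m0) ?(ltW Dz0)// Hm.
Qed.

(** [tau] records the side: [x0] is to the left of [a] when [tau] is 1, and to the right when it is
    -1, which is used only for a = 0. *)
Lemma nearby_point (a r : R) : I01 a -> 0 < r ->
  exists tau x0 : R, [/\ tau * tau = 1, I01 x0 & 0 < tau * (a - x0) <= r].
Proof.
move=> /I01P /andP[a0 a1] r0; have [ap|an] := ltP 0 a.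
  exists 1, (a - Num.min r a); split; first by rewrite mulr1.
    by apply/I01P; rewrite subr_ge0 ge_min lexx orbT /= (le_trans _ a1)// gerBl le_min a0 ltW.
  by rewrite mul1r subKr lt_min r0 ap ge_min lexx.
have -> : a = 0 by apply/eqP; rewrite eq_le an a0.
exists (-1), (Num.min r 1); split; first by rewrite mulrNN mulr1.
  by apply/I01P; rewrite le_min ler01 (ltW r0) ge_min lexx orbT.
by rewrite sub0r mulrNN mul1r lt_min r0 ltr01 ge_min lexx.
Qed.

Lemma growth_lower a : I01 a -> f a = a -> derivI (derivI f) a <> 0 ->
  exists2 k : R, 0 < k & forall n, (1 <= n)%N -> k * n%:R ^+ 2 <= growth_pair n.
Proof.
move=> Ia fa /eqP f2a.
have ha : h a = a by rewrite -[in LHS]fa fK.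
have fa1 := parabolic Ia fa.
have ha1 : derivI h a = 1.
  by have := deriv_inverse fI fK fC2 hC2 Ia; rewrite fa fa1 mulr1.
have [r [c [r0 c0 Hq]]] : exists r c : R, [/\ 0 < r, 0 < c & forall y, I01 y -> `|y - a| <= r ->
    c * (y - a) ^+ 2 <= Num.sg (derivI (derivI f) a) * (f y - y)].
  apply: (@quadratic_growth _ (fun y => f y - y) (fun y => derivI f y - 1) (derivI (derivI f))) => //.
  - by move=> y Iy; apply: has_derivIB; [exact: C2I_has_derivI | exact: has_derivI_id].
  - move=> y Iy; rewrite -[derivI (derivI f) y]subr0.
    by apply: has_derivIB; [exact: C2I_has_derivI2 | exact: has_derivI_cst].
  - by have [] := fC2.
  - by rewrite fa subrr.
  - by rewrite fa1 subrr.
set s := Num.sg _ in Hq.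
have s2 : s * s = 1 by rewrite -expr2 sqr_sg f2a.
have [r' [c' [r'0 c'0 Hq']]] := inverse_quadratic_growth r0 c0 Ia fa Hq.
have rr : 0 < Num.min r r' by rewrite lt_min r0.
have [tau [x0 [tau2 Ix0 /andP[x0a x0r]]]] := nearby_point Ia rr.
have [x0r1 x0r2] : tau * (a - x0) <= r /\ tau * (a - x0) <= r'.
  by move: x0r; rewrite le_min => /andP.
have : (tau - s) * (tau + s) == 0 by rewrite -subr_sqr !expr2 tau2 s2 subrr.
(* If tau = s, then [f] pulls [x0] towards [a] and the iterates of [h] have the large derivative; if
   tau = - s, the roles are exchanged. *)
rewrite mulf_eq0 => /orP[/eqP ts|/eqP ts].
- have tauE : tau = s by apply/eqP; rewrite -subr_eq0 ts.
  rewrite -tauE in Hq.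
  have [m [L [K [m0 K0 Hm _ HK]]]] := diffeo_bounds hI hK hC2 fC2 h0 h1.
  have [k k0 Hk] := orbit_prod_ge hI (fun x => C2I_has_derivI hC2) m0 Hm K0 HK fI fK hK
    (diffeo_increasing fI fK fC2 hC2 f0 f1) Ia Ix0 fa ha1 tau2 c0 (introT andP (conj x0a x0r1)) Hq.
  exists k => // n /Hk[y Iy ky]; rewrite /growth_pair le_max; apply/orP; right.
  exact: (le_trans ky (max_deriv_ge hI hK hC2 fC2 h0 h1 n Iy)).
- have tauE : tau = - s by apply/eqP; rewrite -addr_eq0 ts.
  rewrite -tauE in Hq'.
  have [m [L [K [m0 K0 Hm _ HK]]]] := diffeo_bounds fI fK fC2 hC2 f0 f1.
  have [k k0 Hk] := orbit_prod_ge fI (fun x => C2I_has_derivI fC2) m0 Hm K0 HK hI hK fK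
    (diffeo_increasing hI hK hC2 fC2 h0 h1) Ia Ix0 ha fa1 tau2 c'0 (introT andP (conj x0a x0r2)) Hq'.
  exists k => // n /Hk[y Iy ky]; rewrite /growth_pair le_max; apply/orP; left.
  exact: (le_trans ky (max_deriv_ge fI fK fC2 hC2 f0 f1 n Iy)).
Qed.

End GrowthOfInversePair.

(** * Conclusion for [Diff20] *)

Lemma invI_inverse (R : realType) (f : R -> R) : set_bij (@I01 R) (@I01 R) f ->
  [/\ forall x, I01 x -> I01 (f x), forall x, I01 x -> I01 (invI f x),
      forall x, I01 x -> invI f (f x) = x & forall x, I01 x -> f (invI f x) = x].
Proof.
move=> fbij; have [/= fI finj fsurj] := fbij.
have [hI _ _] : set_bij (@I01 R) (@I01 R) (invI f) by exact: bijpinv_bij.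
split.
- by move=> x Ix; apply: fI.
- by move=> x Ix; apply: hI.
- by move=> x Ix; rewrite /invI pinvKV ?inE.
- by move=> x Ix; rewrite /invI (surjpK (fun=> point) fsurj)// inE.
Qed.

Theorem mainTheorem2 (R : realType) (f : R -> R) (hf : Diff20 f) :
  (E1 f = set0 -> E2 f !=set0 ->
     same_order (growth f) (fun n : nat => (n%:R : R) ^+ 2)) /\
  (E1 f = set0 -> E2 f = set0 ->
     growth f =o_\oo (fun n : nat => (n%:R : R) ^+ 2)).
Proof.
have [fbij fC2 hC2 f0 f1] := hf; have [fI hI fK hK] := invI_inverse fbij.
have parab : E1 f = set0 -> forall x, I01 x -> f x = x -> derivI f x = 1.
  move=> E x Ix fx; apply: contrapT => ne.
  by have : E1 f x by []; rewrite E.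
split=> [/parab par [a [[Ia fa] _ f2a]]|E1f E2f].
- have [C C0 HC] := growth_upper fI hI fK hK fC2 hC2 f0 f1 par.
  have [k k0 Hk] := growth_lower fI hI fK hK fC2 hC2 f0 f1 par Ia fa f2a.
  have [_ _ f2c] := fC2; have [B B0 HB] := within_I01_bounded f2c.
  (* [B] bounds the second derivative on all of [0, 1], so any positive [eta] serves. *)
  have [A A0 HA] := HC B 1 B0 ltr01 (fun y Iy _ => HB y Iy).
  (* For n >= 1, A <= A * n absorbs [A] into the linear term. *)
  exists k, (C * (A + Num.sqrt B * C) ^+ 2); split => // n n1.
  have n0 : 0 < n%:R :> R by rewrite ltr0n.
  have n20 : 0 < n%:R ^+ 2 :> R by rewrite exprn_gt0.
  rewrite ler_pdivlMr// ler_pdivrMr// Hk//=.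
  apply: (le_trans (HA n)); rewrite -mulrA ler_pM2l// -exprMn.
  have SC : 0 <= Num.sqrt B * C by rewrite mulr_ge0 ?sqrtr_ge0 ?ltW.
  have X0 : 0 <= A + n%:R * (Num.sqrt B * C) by rewrite addr_ge0// mulr_ge0.
  have Y0 : 0 <= (A + Num.sqrt B * C) * n%:R by rewrite mulr_ge0// addr_ge0.
  rewrite ler_pXn2r ?nnegrE//.
  by rewrite mulrDl [_ * C * _]mulrC lerD2r ler_peMr// ler1n.
- have par := parab E1f.
  have [C C0 HC] := growth_upper fI hI fK hK fC2 hC2 f0 f1 par.
  (* [B] is chosen so that C * (2 * n * sqrt B * C) ^ 2 = e * n ^ 2. *)
  apply/eqoP => e e0; pose B := e / (4 * C ^+ 3).
  have B0 : 0 < B by rewrite divr_gt0// mulr_gt0// exprn_gt0.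
  have [_ _ f2c] := fC2.
  have gz y : I01 y -> f y - y = 0 -> derivI (derivI f) y = 0.
    move=> Iy /eqP; rewrite subr_eq0 => /eqP fy; apply: contrapT => ne.
    have : E2 f y by split => //; exact: par.
    by rewrite E2f.
  have [|eta eta0 Heta] := @small_second_derivative _ (fun y => f y - y)
      (fun y => derivI f y - 1) _ B _ f2c gz B0.
    by move=> y Iy; apply: has_derivIB; [exact: C2I_has_derivI | exact: has_derivI_id].
  have [A A0 HA] := HC B eta (ltW B0) eta0 Heta.
  have SC : 0 < Num.sqrt B * C by rewrite mulr_gt0 ?sqrtr_gt0.
  (* From this rank on, A <= n * sqrt B * C, so [A] at most doubles the linear term. *)
  exists (Num.truncn (A / (Num.sqrt B * C))).+1 => //= n /= Nn.
  have An : A <= n%:R * (Num.sqrt B * C).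
    rewrite -ler_pdivrMr//; apply: ltW; apply: (lt_le_trans (truncnS_gt _)).
    by rewrite ler_nat.
  rewrite gtr0_norm; last exact: (growth_gt0 fI fK fC2 hC2 f0 f1).
  rewrite ger0_norm ?sqr_ge0//; apply: (le_trans (HA n)).
  have -> : e * n%:R ^+ 2 = C * (n%:R * (Num.sqrt B * C) + n%:R * (Num.sqrt B * C)) ^+ 2.
    transitivity (4 * C ^+ 3 * Num.sqrt B ^+ 2 * n%:R ^+ 2); last by ring.
    by rewrite sqr_sqrtr ?(ltW B0)// /B; field; rewrite gt_eqF.
  have nSC : 0 <= n%:R * (Num.sqrt B * C) by rewrite mulr_ge0// ltW.
  by rewrite ler_pM2l// ler_pXn2r ?nnegrE ?addr_ge0// lerD2r.
Qed.
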